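(* Let $\alpha>1$, $\delta\in(0,\alpha-1)$, $\tau\in(0,\alpha-1-\delta]$, $d\in\mathbb N$, $1\ge\gamma_1\ge\dots\ge\gamma_d>0$, and $g\in\mathcal A_{\alpha,\boldsymbol\gamma,d}$. Let $\boldsymbol x_1,\dots,\boldsymbol x_N\in[0,1]^d$, $c_1,\dots,c_N\in\mathbb R$. Let $L$ be a prime and $\mathcal Z=\{\boldsymbol z_0,\dots,\boldsymbol z_{L-1}\}$ a rank-1 lattice point set of size $L$ satisfying $e(H_{\beta,\boldsymbol\gamma,d},\mathcal Z)\le C_{\boldsymbol\gamma,d}(\beta,\tau')L^{-\beta+\tau'}$ for all $\tau'\in(0,\beta-\frac12]$, where $\beta=\alpha-\frac12-\delta$. Then for every $\nu>1$, with $K=K^\alpha_{\nu,\boldsymbol\gamma,d}$, $$\Big|\frac1N\sum_{n=1}^Nc_ng(\boldsymbol x_n)-\frac1L\sum_{\ell=0}^{L-1}g(\boldsymbol z_\ell)\phi_K(\boldsymbol z_\ell)\Big|\le\mathrm{err}_1(g,\mathcal C)+\mathrm{err}_2(g,\mathcal C)\le\|g\|_{\mathcal A_{\alpha,\boldsymbol\gamma,d}}\Big[\frac{1}{\sqrt\nu}+\frac{\sqrt\nu}{L^{\alpha-\frac12-\delta-\tau}}c_{\alpha,\boldsymbol\gamma,d}\,\zeta_{\delta,d}\,C_{\boldsymbol\gamma,d}\big(\alpha-\tfrac12-\delta,\tau\big)\Big]\overline\mu_N.$$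
   Context: For $\beta>0$, $\gamma>0$, $h\in\mathbb Z$: $r_\beta(\gamma,h)=\max(|h|^{2\beta}/\gamma,1)$, $r_\beta(\boldsymbol\gamma,\boldsymbol k)=\prod_{j=1}^dr_\beta(\gamma_j,k_j)$. $\omega_{\boldsymbol k}(\boldsymbol x)=\exp(2\pi i\,\boldsymbol k\cdot\boldsymbol x)$, $\widehat f_{\boldsymbol k}=\int_{[0,1]^d}f\,\overline{\omega_{\boldsymbol k}}$. Weighted Wiener algebra $\mathcal A_{\alpha,\boldsymbol\gamma,d}=\{f\in L_1([0,1]^d):\|f\|_{\mathcal A_{\alpha,\boldsymbol\gamma,d}}=\sum_{\boldsymbol k}\sqrt{r_\alpha(\boldsymbol\gamma,\boldsymbol k)}|\widehat f_{\boldsymbol k}|<\infty\}$ (functions identified with their uniformly convergent Fourier series). Weighted Korobov space ($\beta>1/2$): $H_{\beta,\boldsymbol\gamma,d}=\{f\in L_2:\|f\|_{H_{\beta,\boldsymbol\gamma,d}}=(\sum_{\boldsymbol k}r_\beta(\boldsymbol\gamma,\boldsymbol k)|\widehat f_{\boldsymbol k}|^2)^{1/2}<\infty\}$. Weighted continuous hyperbolic cross: $K^\alpha_{\nu,\boldsymbol\gamma,d}=\{\boldsymbol k\in\mathbb Z^d:r_\alpha(\boldsymbol\gamma,\boldsymbol k)\le\nu\}$. For finite $K$: $\phi_K(\boldsymbol x)=\sum_{\boldsymbol k\in K}\check\phi_{\boldsymbol k}\overline{\omega_{\boldsymbol k}(\boldsymbol x)}$, $\check\phi_{\boldsymbol k}=\frac1N\sum_nc_n\omega_{\boldsymbol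 k}(\boldsymbol x_n)$; $\mathcal C=(c_n)_n$; $\mathrm{err}_1(g,\mathcal C)=|\frac1N\sum_nc_ng(\boldsymbol x_n)-\int_{[0,1]^d}g\phi_K|$ and $\mathrm{err}_2(g,\mathcal C)=|\int_{[0,1]^d}g\phi_K-\frac1L\sum_{\ell=0}^{L-1}(g\phi_K)(\boldsymbol z_\ell)|$. A rank-1 lattice point set of size $L$ with generating vector $\mathfrak g\in\{1,\dots,L-1\}^d$ is $\{\boldsymbol z_\ell=(\ell\mathfrak g/L)\bmod1:\ell=0,\dots,L-1\}$ (componentwise fractional part). Worst-case error: $e(H_{\beta,\boldsymbol\gamma,d},\mathcal Z)=\sup_{\|f\|_{H_{\beta,\boldsymbol\gamma,d}}\le1}|\int_{[0,1]^d}f-\frac1L\sum_\ell f(\boldsymbol z_\ell)|$. Constants: $C_{\boldsymbol\gamma,d}(\beta,\tau)=2^{\beta-\tau}\prod_{j=1}^d[1+2\gamma_j^{1/(2(\beta-\tau))}\zeta(\frac{\beta}{\beta-\tau})]^{\beta-\tau}$; $\overline\mu_N=\frac1N\sum_n|c_n|$; $c_{\alpha,\boldsymbol\gamma,d}=\sqrt{\prod_j\max(1,2^{2\alpha}\gamma_j)}$; $\zeta_{\delta,d}=[1+2\zeta(1+2\delta)]^{d/2}$, $\zeta$ the Riemann zeta function. *)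

(* Defs.v *)
From HB Require Import structures.
From mathcomp Require Import all_boot all_order all_algebra.
From mathcomp Require Import all_classical all_reals all_analysis.
From mathcomp Require Import complex.
Set Implicit Arguments. Unset Strict Implicit. Unset Printing Implicit Defensive.
Import Order.TTheory GRing.Theory Num.Theory.
Import numFieldNormedType.Exports.
Local Open Scope classical_set_scope.
Local Open Scope ring_scope.

Section Defs.
Variable R : realType.
Variable d : nat.

Definition freq := {ffun 'I_d -> int}.
Definition pnt := 'I_d -> R.

Definition in_cube (x : pnt) := forall j, 0 <= x j <= 1.

Definition zeta (s : R) : R := limn (series (riemannR s)).

Definition r1 (beta gam : R) (h : int) : R :=
  Num.max ((`|h|%:~R : R) `^ (2 * beta) / gam) 1.
Definition rw (beta : R) (gam : 'I_d -> R) (k : freq) : R :=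
  \prod_(j < d) r1 beta (gam j) (k j).

Definition omega (k : freq) (x : pnt) : R[i] :=
  let t := 2 * pi * \sum_(j < d) (k j)%:~R * x j in (cos t +i* sin t)%C.

(* iterated Lebesgue integral over [0,1]^n of a real function of
   (nat-indexed) points; coordinate n-1 is integrated outermost *)
Fixpoint iint (n : nat) (f : (nat -> R) -> R) : R :=
  match n with
  | 0 => f (fun _ => 0)
  | n'.+1 => Rintegral lebesgue_measure `[0, 1]%classic
               (fun t => iint n' (fun y => f (fun i => if i == n' then t else y i)))
  end.

Definition rint (f : pnt -> R) : R := iint d (fun y => f (fun j => y (val j))).
Definition cint (f : pnt -> R[i]) : R[i] :=
  (rint (fun x => complex.Re (f x)) +i* rint (fun x => complex.Im (f x)))%C.

Definition fcoef (f : pnt -> R[i]) (k : freq) : R[i] :=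
  cint (fun x => f x * conjc (omega k x)).

Definition box (M : nat) : set freq := [set k | forall j, `|k j| <= M%:Z].

Definition fpsum (f : pnt -> R[i]) (M : nat) (x : pnt) : R[i] :=
  \sum_(k \in box M) fcoef f k * omega k x.

Definition fourier_rep (f : pnt -> R[i]) :=
  forall x, in_cube x -> (fun M => Normc.normc (fpsum f M x - f x)) @ \oo --> (0 : R).

Definition wiener_psum (alpha : R) (gam : 'I_d -> R) (f : pnt -> R[i]) (M : nat) : R :=
  \sum_(k \in box M) Num.sqrt (rw alpha gam k) * Normc.normc (fcoef f k).
Definition wiener_norm alpha gam f : R := limn (wiener_psum alpha gam f).
Definition in_wiener alpha gam f :=
  fourier_rep f /\ cvgn (wiener_psum alpha gam f).

Definition korobov_psum (beta : R) (gam : 'I_d -> R) (f : pnt -> R[i]) (M : nat) : R :=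
  \sum_(k \in box M) rw beta gam k * Normc.normc (fcoef f k) ^+ 2.
Definition korobov_norm beta gam f : R := Num.sqrt (limn (korobov_psum beta gam f)).
Definition korobov_ball beta gam (f : pnt -> R[i]) :=
  fourier_rep f /\ cvgn (korobov_psum beta gam f) /\ korobov_norm beta gam f <= 1.

Definition qmc (L : nat) (z : 'I_L -> pnt) (f : pnt -> R[i]) : R[i] :=
  (L%:R)^-1 * \sum_(l < L) f (z l).

Definition lattice (L : nat) (gen : 'I_d -> nat) : 'I_L -> pnt :=
  fun l j => ((l * gen j) %% L)%:R / L%:R.

Definition wce beta gam (L : nat) (z : 'I_L -> pnt) : \bar R :=
  ereal_sup [set (Normc.normc (cint f - qmc z f))%:E | f in korobov_ball beta gam].

Definition hcross alpha gam (nu : R) : set freq := [set k | rw alpha gam k <= nu].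

Definition phicheck (N : nat) (xs : 'I_N -> pnt) (c : 'I_N -> R) (k : freq) : R[i] :=
  (N%:R)^-1 * \sum_(n < N) (c n)%:C%C * omega k (xs n).
Definition phiK (K : set freq) (N : nat) (xs : 'I_N -> pnt) (c : 'I_N -> R) (x : pnt) : R[i] :=
  \sum_(k \in K) phicheck xs c k * conjc (omega k x).

Definition err1 K N (xs : 'I_N -> pnt) c (g : pnt -> R[i]) : R :=
  Normc.normc ((N%:R)^-1 * \sum_(n < N) (c n)%:C%C * g (xs n) - cint (fun x => g x * phiK K xs c x)).
Definition err2 K N (xs : 'I_N -> pnt) c L (z : 'I_L -> pnt) (g : pnt -> R[i]) : R :=
  Normc.normc (cint (fun x => g x * phiK K xs c x) - qmc z (fun x => g x * phiK K xs c x)).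

Definition Cgd (gam : 'I_d -> R) (beta tau : R) : R :=
  2 `^ (beta - tau) *
  \prod_(j < d) (1 + 2 * gam j `^ (1 / (2 * (beta - tau))) * zeta (beta / (beta - tau))) `^ (beta - tau).
Definition mubar N (c : 'I_N -> R) : R := (N%:R)^-1 * \sum_(n < N) `|c n|.
Definition cagd (alpha : R) (gam : 'I_d -> R) : R :=
  Num.sqrt (\prod_(j < d) Num.max 1 (2 `^ (2 * alpha) * gam j)).
Definition zetad (delta : R) : R := (1 + 2 * zeta (1 + 2 * delta)) `^ (d%:R / 2).

End Defs.

(* Main.v *)
(** The functional [g |-> (1/N) sum_n c_n g(x_n)] equals [sum_k phi_k ghat_k],
    where [ghat_k] are the Fourier coefficients of [g] and [phi_k] those of the
    point evaluations, bounded by [mubar c].  Replacing it by the integral of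
    [g * phiK] drops the frequencies outside the hyperbolic cross, each of which
    has weight [sqrt (rw k) > sqrt nu]; this gives the bound on [err1].

    For [err2], the coefficients of [g * phiK] are the finite sums
    [sum_(k in K) phi_k ghat_(k+h)].  Submultiplicativity
    [sqrt (rw h) <= cagd * sqrt (rw k) * sqrt (rw (k+h))] bounds
    [sqrt (rw h)] times the [h]-th coefficient uniformly in [h], and passing from
    the weight of order [alpha] to that of order [beta] gains the summable factor
    [prod_j |h_j|^-(1+2 delta)].  So [g * phiK] lies in a multiple of the unit
    ball of the Korobov space, where the worst-case error applies.

    No orthogonality of the exponentials is needed, only linearity of the iterated
    integral on functions that are uniformly continuous on the cube, a class
    containing [g] because its Fourier series converges uniformly there. *)
Require Import Defs.
From HB Require Import structures.
From mathcomp Require Import all_boot all_order all_algebra finmap.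
From mathcomp Require Import all_classical all_reals all_analysis.
From mathcomp Require Import complex.
From mathcomp Require Import ring lra zify.
Import Order.TTheory GRing.Theory Num.Theory.
Import numFieldNormedType.Exports.
Local Open Scope classical_set_scope.
Local Open Scope ring_scope.

(** * Iterated integrals of uniformly continuous functions *)

Section iterated_integral.
Context {R : realType}.
Implicit Types (n : nat) (f g : (nat -> R) -> R).

Definition unit_cube n : set (nat -> R) :=
  [set y | forall i, (i < n)%N -> 0 <= y i <= 1].

(** Closeness is asked of the first [n] coordinates only, so on the cube such an [f] depends on
    these alone, as [iint n] requires of its integrand. *)
Definition ucont n f := forall e : R, 0 < e -> exists2 del : R, 0 < del &
  forall x y, unit_cube n x -> unit_cube n y ->
    (forall i, (i < n)%N -> `|x i - y i| <= del) -> `|f x - f y| <= e.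

Definition section n f (t : R) (y : nat -> R) : R :=
  f (fun i => if i == n then t else y i).

Lemma unit_cube_section n t y : 0 <= t <= 1 -> unit_cube n y ->
  unit_cube n.+1 (fun i => if i == n then t else y i).
Proof.
move=> t01 cy i; rewrite ltnS leq_eqVlt; case: eqP => //= _ /cy //.
Qed.

Lemma ucont_section n f t : 0 <= t <= 1 -> ucont n.+1 f -> ucont n (section n f t).
Proof.
move=> t01 uf e /uf[del del0 H]; exists del => // x y cx cy xy.
apply: H; [exact: unit_cube_section|exact: unit_cube_section|].
move=> i; rewrite ltnS leq_eqVlt; case: eqP => //= _ ?; last exact: xy.
by rewrite subrr normr0 ltW.
Qed.

Lemma ucontDZ n f g a : ucont n f -> ucont n g -> ucont n (fun y => f y + a * g y).
Proof.
move=> uf ug e e0.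
have [df df0 Hf] := uf _ (divr_gt0 e0 (ltr0Sn R 1)).
have a1 : 0 < `|a| + 1 by rewrite ltr_wpDl.
have [dg dg0 Hg] := ug _ (divr_gt0 (divr_gt0 e0 (ltr0Sn R 1)) a1).
exists (Num.min df dg); first by rewrite lt_min df0.
move=> x y cx cy xy.
have {}Hf : `|f x - f y| <= e / 2.
  by apply: Hf => // i /xy /le_trans; apply; rewrite ge_min lexx.
have {}Hg : `|g x - g y| <= e / 2 / (`|a| + 1).
  by apply: Hg => // i /xy /le_trans; apply; rewrite ge_min lexx orbT.
rewrite (_ : _ - _ = (f x - f y) + a * (g x - g y)); last by ring.
apply: (le_trans (ler_normD _ _)); rewrite [leRHS]splitr lerD// normrM.
apply: (@le_trans _ _ ((`|a| + 1) * `|g x - g y|)).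
  by rewrite ler_wpM2r// lerDl.
by rewrite mulrC -ler_pdivlMr.
Qed.

Lemma uniform_continuous_integrable (F : R -> R) :
  (forall e : R, 0 < e -> exists2 del : R, 0 < del &
    forall s t : R, 0 <= s <= 1 -> 0 <= t <= 1 -> `|s - t| <= del -> `|F s - F t| <= e) ->
  lebesgue_measure.-integrable `[(0 : R), 1] (EFin \o F).
Proof.
move=> uF; apply: continuous_compact_integrable; first exact: segment_compact.
apply/continuous_within_itvP => //; split.
- move=> x /[!in_itv]/= /andP[x0 x1]; apply/cvgrPdist_le => e /uF[del del0 H].
  near=> t.
  have t0 : 0 < t by near: t; exact: lt_nbhsr.
  have t1 : t < 1 by near: t; exact: lt_nbhsl.
  have xt : `|x - t| <= del by near: t; exact: cvgr_dist_le.
  by apply: H => //; apply/andP; split; exact: ltW.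
- apply/cvgrPdist_le => e /uF[del del0 H].
  near=> t.
  have t0 : 0 <= t by near: t; exact: nbhs_right_ge.
  have t1 : t <= 1 by near: t; exact: nbhs_right_le.
  have xt : t - 0 < del by near: t; exact: nbhs_right_ltDr.
  apply: H; rewrite ?lexx ?ler01 ?t0//.
  by rewrite distrC subr0 ger0_norm// -[leLHS]subr0 ltW.
- apply/cvgrPdist_le => e /uF[del del0 H].
  near=> t.
  have t0 : 0 <= t by near: t; exact: nbhs_left_ge.
  have t1 : t <= 1 by near: t; exact: nbhs_left_le.
  have xt : 1 - t < del by near: t; exact: nbhs_left_ltBl.
  apply: H; rewrite ?lexx ?ler01 ?t0//.
  by rewrite ger0_norm ?subr_ge0// ltW.
Unshelve. all: by end_near. Qed.

Lemma iintS n f : iint n.+1 f =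
  \int[lebesgue_measure]_(t in `[0, 1]) iint n (section n f t).
Proof. by []. Qed.

(** Both claims go through one induction: the outer integrand is integrable because linearity turns
    the difference of two inner integrals into the integral of a difference, which the bound then
    makes small. *)
Lemma iint_linear_bounded n :
  (forall f g a, ucont n f -> ucont n g ->
    iint n (fun y => f y + a * g y) = iint n f + a * iint n g) /\
  (forall f (B : R), ucont n f ->
    (forall y, unit_cube n y -> `|f y| <= B) -> `|iint n f| <= B).
Proof.
elim: n => [|n [IHl IHb]]; first by split => // f B _; apply.
have int_section f : ucont n.+1 f ->
    lebesgue_measure.-integrable `[0, 1]
      (EFin \o (fun t : R => iint n (section n f t))).
  move=> uf; apply: uniform_continuous_integrable => e e0.
  have [del del0 H] := uf _ e0; exists del => // s t s01 t01 st.
  have <- : iint n (fun y => section n f s y + (-1) * section n f t y) =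
      iint n (section n f s) - iint n (section n f t).
    by rewrite IHl ?mulN1r//; exact: ucont_section.
  apply: IHb => [|y cy]; first by apply: ucontDZ; exact: ucont_section.
  rewrite mulN1r; apply: H; [exact: unit_cube_section|exact: unit_cube_section|].
  by move=> i _; case: eqP => // _; rewrite subrr normr0 ltW.
have mitv : measurable (`[0, 1]%classic : set R) by exact: measurable_itv.
split=> [f g a uf ug|f B uf fB].
  rewrite !iintS -RintegralZl//; last exact: int_section.
  rewrite -RintegralD//; [|exact: int_section|]; last first.
    rewrite [X in integrable _ _ X](_ : _ =
      (fun x => a%:E * (EFin \o (fun t : R => iint n (section n g t))) x)%E)//.
    by apply: integrableZl => //; exact: int_section.
  apply: eq_Rintegral => t; rewrite inE/= in_itv/= => t01.
  by rewrite -IHl//; exact: ucont_section.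
rewrite iintS; apply: (le_trans (le_normr_Rintegral _ _)) => //.
  exact: int_section.
have -> : B = \int[lebesgue_measure]_(t in `[0, 1]) (cst B t).
  rewrite Rintegral_cst//= lebesgue_measure_itv/= lte_fin ltr01.
  by rewrite oppr0 adde0 mulr1.
apply: le_Rintegral => //.
- exact: (integrable_norm (int_section _ uf)).
- apply: continuous_compact_integrable; first exact: segment_compact.
  by apply: continuous_subspaceT => x; exact: cvg_cst.
move=> t; rewrite /= in_itv/= => t01; apply: IHb; first exact: ucont_section.
by move=> y cy; apply: fB; exact: unit_cube_section.
Qed.

End iterated_integral.

(** * The modulus of complex numbers *)

Local Notation normc := Normc.normc.

Section normc.
Context {R : rcfType}.
Implicit Types x y z : R[i].

Lemma normc_ge0 x : 0 <= normc x.
Proof. by case: x => a b; exact: sqrtr_ge0. Qed.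

Lemma ler_normcD x y : normc (x + y) <= normc x + normc y.
Proof. exact: le_normcD. Qed.

Lemma normc_opp x : normc (- x) = normc x.
Proof. exact: normcN. Qed.

Lemma normc_sub x y : normc (x - y) = normc (y - x).
Proof. by rewrite -normc_opp opprB. Qed.

Lemma ler_dist_normcD z x y : normc (x - y) <= normc (x - z) + normc (z - y).
Proof. by rewrite -[x - y](subrKA z) ler_normcD. Qed.

Lemma ler_normc_sum (I : Type) (r : seq I) (P : pred I) (F : I -> R[i]) :
  normc (\sum_(i <- r | P i) F i) <= \sum_(i <- r | P i) normc (F i).
Proof.
elim/big_rec2: _ => [|i y x _]; first by rewrite Normc.normc0.
by move=> yx; apply: (le_trans (ler_normcD _ _)); rewrite lerD2l.
Qed.

Lemma normc_conj x : normc x^*%C = normc x.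
Proof. by case: x => a b /=; rewrite sqrrN. Qed.

Lemma normc_real (a : R) : normc a%:C%C = `|a|.
Proof. by rewrite /= expr0n addr0 sqrtr_sqr. Qed.

Lemma normc_nat n : normc n%:R = n%:R :> R.
Proof.
have -> : n%:R = (n%:R)%:C%C :> R[i] by rewrite rmorph_nat.
by rewrite normc_real ger0_norm.
Qed.

Lemma ler_Re_normc x : `|complex.Re x| <= normc x.
Proof. by case: x => a b /=; rewrite -sqrtr_sqr ler_wsqrtr// lerDl sqr_ge0. Qed.

Lemma ler_Im_normc x : `|complex.Im x| <= normc x.
Proof. by case: x => a b /=; rewrite -sqrtr_sqr ler_wsqrtr// lerDr sqr_ge0. Qed.

End normc.

(** * Complex functions uniformly continuous on the cube, and linearity of their integral *)

Section uniformly_continuous.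
Context {R : realType} {d : nat}.
Implicit Types (f g : pnt R d -> R[i]) (x y : pnt R d).

Definition cucont f := forall e : R, 0 < e -> exists2 del : R, 0 < del &
  forall x y, in_cube x -> in_cube y ->
    (forall j, `|x j - y j| <= del) -> normc (f x - f y) <= e.

Lemma cucont_ucont (p : R[i] -> R) f :
  {morph p : z w / z - w} -> (forall z, `|p z| <= normc z) ->
  cucont f -> ucont d (fun u => p (f (fun j => u (val j)))).
Proof.
move=> pB pn uf e /uf[del del0 H]; exists del => // x y cx cy xy.
rewrite -pB; apply: le_trans (pn _) _; apply: H => j.
- exact: cx (ltn_ord j).
- exact: cy (ltn_ord j).
- exact: xy (ltn_ord j).
Qed.

Lemma cucont_Re f : cucont f -> ucont d (fun u => complex.Re (f (fun j => u (val j)))).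
Proof. by apply: cucont_ucont => [[? ?] [? ?]//|]; exact: ler_Re_normc. Qed.

Lemma cucont_Im f : cucont f -> ucont d (fun u => complex.Im (f (fun j => u (val j)))).
Proof. by apply: cucont_ucont => [[? ?] [? ?]//|]; exact: ler_Im_normc. Qed.

Lemma cucont_cst (a : R[i]) : cucont (fun=> a).
Proof.
by move=> e e0; exists 1 => // *; rewrite subrr Normc.normc0 ltW.
Qed.

Lemma cucontD f g : cucont f -> cucont g -> cucont (fun x => f x + g x).
Proof.
move=> uf ug e e0.
have [df df0 Hf] := uf _ (divr_gt0 e0 (ltr0Sn R 1)).
have [dg dg0 Hg] := ug _ (divr_gt0 e0 (ltr0Sn R 1)).
exists (Num.min df dg); first by rewrite lt_min df0.
move=> x y cx cy xy; rewrite opprD addrACA [leRHS]splitr.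
apply: le_trans (ler_normcD _ _) _; apply: lerD.
  by apply: Hf => // j; apply: le_trans (xy j) _; rewrite ge_min lexx.
by apply: Hg => // j; apply: le_trans (xy j) _; rewrite ge_min lexx orbT.
Qed.

Lemma cucontM f g (A B : R) :
  (forall x, in_cube x -> normc (f x) <= A) ->
  (forall x, in_cube x -> normc (g x) <= B) ->
  cucont f -> cucont g -> cucont (fun x => f x * g x).
Proof.
move=> fA gB uf ug e e0.
have A1 : 0 < `|A| + 1 by rewrite ltr_wpDl.
have B1 : 0 < `|B| + 1 by rewrite ltr_wpDl.
have [df df0 Hf] := uf _ (divr_gt0 (divr_gt0 e0 (ltr0Sn R 1)) B1).
have [dg dg0 Hg] := ug _ (divr_gt0 (divr_gt0 e0 (ltr0Sn R 1)) A1).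
exists (Num.min df dg); first by rewrite lt_min df0.
move=> x y cx cy xy.
have -> : f x * g x - f y * g y = (f x - f y) * g y + f x * (g x - g y) by ring.
rewrite [leRHS]splitr.
apply: le_trans (ler_normcD _ _) _; rewrite !Normc.normcM; apply: lerD.
  rewrite -[leRHS](@divfK _ (`|B| + 1)) ?gt_eqF//.
  apply: ler_pM; rewrite ?normc_ge0//.
    by apply: Hf => // j; apply: le_trans (xy j) _; rewrite ge_min lexx.
  by apply: le_trans (gB _ cy) _; rewrite ler_wpDr// ler_norm.
rewrite mulrC -[leRHS](@divfK _ (`|A| + 1)) ?gt_eqF//.
apply: ler_pM; rewrite ?normc_ge0//.
  by apply: Hg => // j; apply: le_trans (xy j) _; rewrite ge_min lexx orbT.
by apply: le_trans (fA _ cx) _; rewrite ler_wpDr// ler_norm.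
Qed.

Lemma cucontZ (a : R[i]) f : cucont f -> cucont (fun x => a * f x).
Proof.
move=> uf e e0.
have a1 : 0 < normc a + 1 by rewrite ltr_wpDl// normc_ge0.
have [del del0 H] := uf _ (divr_gt0 e0 a1); exists del => // x y cx cy xy.
rewrite -mulrBr Normc.normcM -[leRHS](@divfK _ (normc a + 1)) ?gt_eqF//.
by rewrite mulrC; apply: ler_pM; rewrite ?normc_ge0 ?H// lerDl.
Qed.

Lemma cucont_sum (I : Type) (r : seq I) (F : I -> pnt R d -> R[i]) :
  (forall i, cucont (F i)) -> cucont (fun x => \sum_(i <- r) F i x).
Proof.
move=> uF; elim: r => [|i r IHr].
  by under eq_fun do rewrite big_nil; exact: cucont_cst.
by under eq_fun do rewrite big_cons; exact: cucontD.
Qed.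

Lemma cucont_uniform_limit f :
  (forall e : R, 0 < e -> exists2 h, cucont h &
     forall x, in_cube x -> normc (f x - h x) <= e) -> cucont f.
Proof.
move=> H e e0; have e4 : 0 < e / 4 by lra.
have [h uh fh] := H _ e4; have [del del0 {}uh] := uh _ e4.
exists del => // x y cx cy xy.
apply: (le_trans (ler_dist_normcD (h x) _ _)).
apply: (@le_trans _ _ (e / 4 + (normc (h x - h y) + normc (h y - f y)))).
  by rewrite lerD ?fh// ler_dist_normcD.
have := uh x y cx cy xy; have := fh y cy; rewrite normc_sub; lra.
Qed.

Lemma cintDZ f g (a : R[i]) : cucont f -> cucont g ->
  cint (fun x => f x + a * g x) = cint f + a * cint g.
Proof.
move=> uf ug; rewrite /cint /rint.
have [lin _] := @iint_linear_bounded R d.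
have [ufr ufi ugr ugi] := And4 (cucont_Re _ uf) (cucont_Im _ uf)
  (cucont_Re _ ug) (cucont_Im _ ug).
(* The real and imaginary parts of [f + a * g] are each a real combination of three real
   functions. *)
have linD (u v w : (nat -> R) -> R) b c : ucont d u -> ucont d v -> ucont d w ->
    iint d (fun t => u t + b * v t + c * w t) = iint d u + b * iint d v + c * iint d w.
  by move=> uu uv uw; rewrite -!lin//; exact: ucontDZ.
apply/eqP; rewrite eq_complex/=; apply/andP; split; apply/eqP.
  pose fr t := complex.Re (f (fun j => t (val j))).
  pose gr t := complex.Re (g (fun j => t (val j))).
  pose gi t := complex.Im (g (fun j => t (val j))).
  transitivity (iint d (fun t => fr t + complex.Re a * gr t + (- complex.Im a) * gi t)).
    congr (iint d _); apply/funext => y; rewrite /fr /gr /gi.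
    by case: (f _) (g _) a => [? ?] [? ?] [? ?] /=; ring.
  by rewrite linD// /fr /gr /gi; case: a => ? ? /=; ring.
pose fi t := complex.Im (f (fun j => t (val j))).
pose gr t := complex.Re (g (fun j => t (val j))).
pose gi t := complex.Im (g (fun j => t (val j))).
transitivity (iint d (fun t => fi t + complex.Re a * gi t + complex.Im a * gr t)).
  congr (iint d _); apply/funext => y; rewrite /fi /gr /gi.
  by case: (f _) (g _) a => [? ?] [? ?] [? ?] /=; ring.
by rewrite linD// /fi /gr /gi; case: a => ? ? /=; ring.
Qed.

Lemma cint_sum (I : Type) (r : seq I) (a : I -> R[i]) (F : I -> pnt R d -> R[i]) :
  (forall i, cucont (F i)) ->
  cint (fun x => \sum_(i <- r) a i * F i x) = \sum_(i <- r) a i * cint (F i).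
Proof.
move=> uF; elim: r => [|i r IHr].
  under eq_fun do rewrite big_nil; rewrite big_nil.
  (* The integral I of 0 vanishes, being equal to I + (-1) I. *)
  have := @cintDZ (cst 0) (cst 0) (- 1) (cucont_cst 0) (cucont_cst 0).
  by rewrite mulN1r subrr; under eq_fun do rewrite mulr0 addr0.
rewrite big_cons -IHr addrC -cintDZ//; last first.
  by apply: cucont_sum => j; exact: cucontZ.
by congr cint; apply/funext => x; rewrite big_cons addrC.
Qed.

End uniformly_continuous.

(** * The exponentials as uniformly continuous characters of modulus one *)

Section omega.
Context {R : realType} {d : nat}.
Implicit Types (k h : freq d) (x y : pnt R d).

Definition phase k x : R := 2 * pi * \sum_(j < d) (k j)%:~R * x j.

Lemma omegaE k x : omega k x = (cos (phase k x) +i* sin (phase k x))%C.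
Proof. by []. Qed.

Lemma normc_omega k x : normc (omega k x) = 1.
Proof. by rewrite omegaE /= cos2Dsin2 sqrtr1. Qed.

Lemma omegaD k h x : omega (k + h) x = omega k x * omega h x.
Proof.
rewrite !omegaE (_ : phase (k + h) x = phase k x + phase h x); last first.
  rewrite /phase -mulrDr -big_split/=; congr (_ * _); apply: eq_bigr => j _.
  by rewrite ffunE intrD mulrDl.
by rewrite cosD sinD; apply/eqP; rewrite eq_complex/=; apply/andP; split;
  apply/eqP; ring.
Qed.

Lemma omega_conjM k x : omega k x * (omega k x)^*%C = 1.
Proof.
rewrite omegaE; apply/eqP; rewrite eq_complex/= !mulrN opprK -!expr2 cos2Dsin2.
by rewrite eqxx/= [X in - X + _]mulrC addNr.
Qed.

(** The squared distance of two values is 2 - 2 cos of the phase difference, so continuity of cos at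
    0 suffices, together with a Lipschitz bound on the phase. *)
Lemma cucont_omega k : cucont (@omega R d k).
Proof.
move=> e e0.
have /cvgr_dist_le/(_ (e ^+ 2 / 2)) : cos x @[x --> (0 : R)] --> cos (0 : R).
  exact: continuous_cos.
move=> /(_ _)/nbhs_normP[|eta/= eta0 Heta]; first by rewrite divr_gt0// exprn_gt0.
(* A Lipschitz constant of the phase for the sup distance; it is 0 for [k = 0], hence the division
   by [S + 1] below. *)
pose S := 2 * pi * \sum_(j < d) `|(k j)%:~R : R|.
have S0 : 0 <= S by rewrite mulr_ge0 ?mulr_ge0 ?pi_ge0// sumr_ge0.
have S1 : 0 < S + 1 by rewrite ltr_wpDl.
exists (eta / 2 / (S + 1)); first by rewrite !divr_gt0.
move=> x y cx cy xy.
have dphase : `|phase k x - phase k y| < eta.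
  rewrite /phase -mulrBr -sumrB normrM (ger0_norm (x := 2 * pi)) ?mulr_ge0 ?pi_ge0//.
  apply: (@le_lt_trans _ _ (S * (eta / 2 / (S + 1)))).
    rewrite /S -[leRHS]mulrA ler_wpM2l ?mulr_ge0 ?pi_ge0// mulr_suml.
    apply: le_trans (ler_norm_sum _ _ _) _; apply: ler_sum => j _.
    by rewrite -mulrBr normrM ler_wpM2l.
  apply: (@le_lt_trans _ _ (eta / 2)); last by lra.
  rewrite mulrCA; apply: ler_piMr; first by rewrite divr_ge0// ltW.
  by rewrite ler_pdivrMr// mul1r lerDl.
have := Heta (phase k x - phase k y); rewrite /= add0r normrN => /(_ dphase).
rewrite cos0 => /(le_trans (ler_norm _)) hcos.
rewrite -/(phase k x) -/(phase k y) -(ger0_norm (ltW e0)) -sqrtr_sqr ler_wsqrtr//.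
move: hcos; rewrite cosB => hcos.
have := cos2Dsin2 (phase k x); have := cos2Dsin2 (phase k y).
by move: hcos; nra.
Qed.

End omega.

(** * Comparison of sums over finite sets *)

Section finite_sums.
Context {R : realType} {T : choiceType}.
Implicit Types (A B : set T).

Lemma ler_fsum_subset A B (F : T -> R) : finite_set B -> A `<=` B ->
  (forall i, 0 <= F i) -> \sum_(i \in A) F i <= \sum_(i \in B) F i.
Proof.
move=> finB AB F0; rewrite [leRHS](fsbigID A)// setIidr//.
by rewrite lerDl fsumr_ge0.
Qed.

Lemma ler_fsum A (F G : T -> R) : finite_set A ->
  (forall i, A i -> F i <= G i) -> \sum_(i \in A) F i <= \sum_(i \in A) G i.
Proof.
move=> finA FG; rewrite !fsbig_finite// big_seq [leRHS]big_seq.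
by apply: ler_sum => i; rewrite in_fset_set// inE; exact: FG.
Qed.

Lemma ler_normc_fsum A (F : T -> R[i]) : finite_set A ->
  normc (\sum_(i \in A) F i) <= \sum_(i \in A) normc (F i).
Proof. by move=> finA; rewrite !fsbig_finite// ler_normc_sum. Qed.

End finite_sums.

(** * Boxes of frequencies *)

Section boxes.
Context {d : nat}.
Implicit Types (M : nat) (k h : freq d).

(** Indexing the box by finite functions makes sums over it accessible to distributivity of products
    over sums; the index [M] stands for the frequency 0. *)
Definition box_point M (f : {ffun 'I_d -> 'I_(M.*2.+1)}) : freq d :=
  [ffun j => (val (f j))%:Z - M%:Z].

Lemma box_point_inj M : injective (box_point M).
Proof.
move=> f g fg; apply/ffunP => j; apply/val_inj.
have := congr1 (fun k : freq d => k j) fg; rewrite !ffunE => /addIr [].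
by [].
Qed.

Lemma boxE M : box M = range (box_point M).
Proof.
apply/seteqP; split => [k kM|_ [f _ <-] j]; last first.
  by rewrite ffunE; case: (f j) => n /= nM; lia.
have H j : (absz (k j + M%:Z)%R < M.*2.+1)%N by have := kM j; lia.
exists [ffun j => Ordinal (H j)] => //.
by apply/ffunP => j; rewrite !ffunE/=; have := kM j; lia.
Qed.

Lemma finite_box M : finite_set (box (d := d) M).
Proof. by rewrite boxE; apply: finite_image; exact: finite_finset. Qed.

Lemma subset_box M1 M2 : (M1 <= M2)%N -> box (d := d) M1 `<=` box M2.
Proof. by move=> M12 k kM j; have := kM j; lia. Qed.

Lemma finite_subset_box (A : set (freq d)) : finite_set A -> exists M, A `<=` box M.
Proof.
move=> finA; exists (\max_(k <- fset_set A) \max_(j < d) absz (k j))%N => k Ak j.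
have kA : k \in fset_set A by rewrite in_fset_set// inE.
rewrite -abszE lez_nat; apply: leq_trans (leq_bigmax_seq _ kA _) => //.
exact: (leq_bigmax (F := fun i : 'I_d => absz (k i))).
Qed.

Lemma fsum_boxE (V : nmodType) M (F : freq d -> V) :
  \sum_(k \in box M) F k = \sum_(f : {ffun 'I_d -> 'I_(M.*2.+1)}) F (box_point M f).
Proof.
rewrite boxE fsbig_image; last by move=> ? ? _ _; exact: box_point_inj.
rewrite (fsbigE (index_enum {ffun 'I_d -> 'I_(M.*2.+1)})) ?index_enum_uniq//; last first.
  by move=> f _; rewrite mem_index_enum.
by apply: eq_bigl => f; rewrite in_setT.
Qed.

End boxes.

(** * Functions of the Wiener algebra and the tails of their Fourier series *)

Section wiener.
Context {R : realType} {d : nat}.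
Variables (alpha : R) (gam : 'I_d -> R) (g : pnt R d -> R[i]).
Hypothesis gW : in_wiener alpha gam g.
Implicit Types (k h : freq d) (A D : set (freq d)) (x : pnt R d).

Lemma r1_ge1 (b c : R) n : 1 <= r1 b c n.
Proof. by rewrite le_max lexx orbT. Qed.

Lemma rw_ge1 (b : R) (c : 'I_d -> R) k : 1 <= rw b c k.
Proof.
rewrite /rw; apply: (big_ind (fun z => 1 <= z)) => // [z t|j _]; last exact: r1_ge1.
exact: mulr_ege1.
Qed.

Definition wterm k := Num.sqrt (rw alpha gam k) * normc (fcoef g k).

Lemma wterm_ge0 k : 0 <= wterm k.
Proof. by rewrite mulr_ge0 ?sqrtr_ge0 ?normc_ge0. Qed.

Lemma normc_fcoef_le_wterm k : normc (fcoef g k) <= wterm k.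
Proof.
by rewrite ler_peMl ?normc_ge0// -sqrtr1 ler_wsqrtr// rw_ge1.
Qed.

Lemma wiener_psum_nondecreasing : nondecreasing_seq (wiener_psum alpha gam g).
Proof.
move=> m n mn; apply: ler_fsum_subset; [exact: finite_box| |exact: wterm_ge0].
exact: subset_box.
Qed.

Lemma fsum_wterm_le A : finite_set A -> \sum_(k \in A) wterm k <= wiener_norm alpha gam g.
Proof.
move=> finA; have [M AM] := finite_subset_box _ finA.
apply: (@le_trans _ _ (wiener_psum alpha gam g M)).
  by apply: ler_fsum_subset => //; [exact: finite_box|exact: wterm_ge0].
by apply: nondecreasing_cvgn_le; [exact: wiener_psum_nondecreasing|exact: gW.2].
Qed.

(** Once a box contains [A], its partial sum minus the sum over [A] runs over a finite set disjoint
    from [A]; pointwise convergence of the box sums does the rest. [B] is left free to serve boxes,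
    the empty set and the hyperbolic cross alike. *)
Lemma fourier_tail A (B : R) x : finite_set A -> in_cube x ->
  (forall D, finite_set D -> D `<=` ~` A -> \sum_(k \in D) normc (fcoef g k) <= B) ->
  normc (g x - \sum_(k \in A) fcoef g k * omega k x) <= B.
Proof.
move=> finA cx HB; apply/ler_addgt0Pr => e e0.
have [M0 AM0] := finite_subset_box _ finA.
have /cvgrPdist_le/(_ e e0) Me := gW.1 x cx.
near \oo => M.
have MM0 : (M0 <= M)%N by near: M; exact: nbhs_infty_ge.
have : `|0 - normc (fpsum g M x - g x)| <= e by near: M.
rewrite sub0r normrN ger0_norm ?normc_ge0// normc_sub => gM.
apply: (le_trans (ler_dist_normcD (fpsum g M x) _ _)); rewrite addrC lerD//.
rewrite /fpsum (fsbigID A); last exact: finite_box.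
rewrite setIidr; last by apply: (subset_trans AM0); exact: subset_box.
have finD : finite_set (box M `&` ~` A) by apply: finite_setIl; exact: finite_box.
rewrite addrC addKr; apply: le_trans (ler_normc_fsum _ _ finD) _.
under eq_fsbigr do rewrite Normc.normcM normc_omega mulr1.
by apply: HB => // k [].
Unshelve. all: by end_near. Qed.

(** A finite [D] outside [A] is disjoint from [box M], so the sums over the two together stay below
    the norm. Any [A] containing the box is allowed, since translated boxes occur later. *)
Lemma fourier_tail_box M A x : finite_set A -> box M `<=` A -> in_cube x ->
  normc (g x - \sum_(k \in A) fcoef g k * omega k x)
    <= wiener_norm alpha gam g - wiener_psum alpha gam g M.
Proof.
move=> finA MA cx; apply: fourier_tail => // D finD DA.
rewrite lerBrDr; apply: (@le_trans _ _ (\sum_(k \in D `|` box M) wterm k)).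
  rewrite fsbigU//; first last.
  - by move=> k [/DA + /MA].
  - exact: finite_box.
  rewrite lerD2r; apply: ler_fsum => // k _; exact: normc_fcoef_le_wterm.
by apply: fsum_wterm_le; rewrite finite_setU; split => //; exact: finite_box.
Qed.

Lemma wiener_psum_tail :
  (fun M => wiener_norm alpha gam g - wiener_psum alpha gam g M) @ \oo --> (0 : R).
Proof.
rewrite -(subrr (wiener_norm alpha gam g)); apply: cvgB; first exact: cvg_cst.
exact: gW.2.
Qed.

Lemma wiener_bounded x : in_cube x -> normc (g x) <= wiener_norm alpha gam g.
Proof.
move=> cx; have := fourier_tail set0 (wiener_norm alpha gam g) x (finite_set0 _) cx.
rewrite fsbig_set0 subr0; apply => D finD _; apply: le_trans (fsum_wterm_le _ finD).
by apply: ler_fsum => // k _; exact: normc_fcoef_le_wterm.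
Qed.

Lemma wiener_cucont : cucont g.
Proof.
apply: cucont_uniform_limit => e e0.
have /cvgrPdist_le/(_ e e0) Me := wiener_psum_tail.
near \oo => M; exists (fpsum g M) => [|x cx].
  have -> : fpsum g M = fun x => \sum_(k <- fset_set (box M)) fcoef g k * omega k x.
    by apply/funext => x; rewrite /fpsum fsbig_finite//; exact: finite_box.
  by apply: cucont_sum => k; apply: cucontZ; exact: cucont_omega.
apply: (le_trans (fourier_tail_box M _ _ (finite_box M) (@subset_refl _ _) cx)).
apply: le_trans (ler_norm _) _; rewrite -normrN -sub0r.
by near: M.
Unshelve. all: by end_near. Qed.

End wiener.

(** * Univariate weights, the zeta series and product weights *)

Section weights.
Context {R : realType}.
Implicit Types (a b c s : R) (h k : int).

Lemma r1_0 b c : 0 < b -> r1 b c 0 = 1.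
Proof.
move=> b0; rewrite /r1 normr0 powR0; last by rewrite mulf_neq0 ?gt_eqF.
by rewrite mul0r max_r.
Qed.

Lemma abs_int_ge1 h : h != 0 -> 1 <= (`|h|%:~R : R).
Proof. by move=> h0; rewrite ler1z; move: h0; lia. Qed.

Lemma r1E b c h : 0 < b -> 0 < c <= 1 -> h != 0 -> r1 b c h = `|h|%:~R `^ (2 * b) / c.
Proof.
move=> b0 /andP[c0 c1] h0; rewrite /r1 max_l// ler_pdivlMr// mul1r.
apply: (le_trans c1); rewrite -[leLHS](powRr0 `|h|%:~R) ler_powR ?abs_int_ge1//.
by rewrite mulr_ge0// ltW.
Qed.

(* Only when k and k + h are both nonzero does the factor 2^(2a) c enter:
   |h| <= |k| + |k + h| <= 2 |k| |k + h|. *)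
Lemma r1_submul a c h k : 0 < a -> 0 < c <= 1 ->
  r1 a c h <= Num.max 1 (2 `^ (2 * a) * c) * r1 a c k * r1 a c (k + h).
Proof.
move=> a0 /[dup] c01 /andP[c0 c1]; set m := Num.max _ _.
have m1 : 1 <= m by rewrite /m le_max lexx.
have m0 : 0 <= m := le_trans ler01 m1.
have [->|k0] := eqVneq k 0.
  by rewrite add0r r1_0// mulr1 ler_peMl// (le_trans ler01)// r1_ge1.
have [kh0|kh0] := eqVneq (k + h) 0.
  rewrite kh0 r1_0// mulr1; have -> : r1 a c h = r1 a c k.
    have -> : h = - k by lia.
    by rewrite /r1 normrN.
  by rewrite ler_peMl// (le_trans ler01)// r1_ge1.
have [->|h0] := eqVneq h 0.
  by rewrite r1_0// mulr_ege1 ?r1_ge1// mulr_ege1 ?r1_ge1.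
rewrite !r1E//.
apply: (@le_trans _ _ (2 `^ (2 * a) * c * (`|k|%:~R `^ (2 * a) / c)
   * (`|k + h|%:~R `^ (2 * a) / c))); last first.
  by rewrite !ler_wpM2r ?divr_ge0 ?powR_ge0 1?(ltW c0)// /m le_max lexx orbT.
rewrite (_ : _ * _ * _ = 2 `^ (2 * a) * `|k|%:~R `^ (2 * a) * `|k + h|%:~R `^ (2 * a) / c);
  last by field; rewrite gt_eqF.
apply: ler_wpM2r; first by rewrite invr_ge0 ltW.
rewrite -!powRM ?mulr_ge0 ?ler0z//.
apply: ge0_ler_powR; rewrite ?nnegrE ?mulr_ge0 ?ler0z ?(ltW a0)//.
rewrite -[2]/(2%:~R) -!intrM ler_int.
move: k0 kh0; nia.
Qed.

(** For [h != 0] both maxima are attained by the power, and [c] cancels in the quotient. *)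
Lemma r1_ratio a b s c h : 0 < a -> 0 < b -> 0 < c <= 1 -> 2 * a = 2 * b + s ->
  r1 b c h = r1 a c h * (if h == 0 then 1 else (`|h|%:~R `^ s)^-1).
Proof.
move=> a0 b0 c01 abs; case: eqP => [->|/eqP h0]; first by rewrite !r1_0// mulr1.
have h1 : `|h|%:~R != 0 :> R by rewrite gt_eqF// (lt_le_trans ltr01)// abs_int_ge1.
rewrite !r1E// abs powRD ?h1 ?implybT//.
have /andP[c0 _] := c01; field.
by rewrite powR_eq0 (negbTE h1)/= gt_eqF.
Qed.

(** Cauchy condensation: a dyadic block of 2^m terms, each at most (2^m)^-s, sums to at most q^m
    with q = 2^(1-s) < 1. *)
Lemma riemannR_cvg s : 1 < s -> cvgn (series (riemannR s)).
Proof.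
move=> s1; have s0 : 0 <= s by rewrite (le_trans ler01)// ltW.
have nd : nondecreasing_seq (series (riemannR s)).
  by apply: nondecreasing_series => n _ _; rewrite ltW// riemannR_gt0.
pose q : R := 2 `^ (1 - s).
have q0 : 0 <= q by exact: powR_ge0.
have q1 : q < 1.
  rewrite /q /powR pnatr_eq0/= expR_lt1 nmulr_rlt0 ?subr_lt0//.
  by rewrite ln_gt0// ltr1n.
(* The term of index i is (i+1)^-s, so the first 2^m - 1 terms are those with base below 2^m. *)
have dyadic m : series (riemannR s) (2 ^ m).-1 <= series (geometric 1 q) m.
  elim: m => [|m IHm]; first by rewrite /series/= !big_geq.
  have p0 : (0 < 2 ^ m)%N by rewrite expn_gt0.
  have pE : ((2 ^ m.+1).-1 = (2 ^ m).-1 + 2 ^ m)%N by rewrite expnS; lia.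
  rewrite /series/= pE (big_cat_nat (n := (2 ^ m).-1))//=; last exact: leq_addr.
  rewrite big_nat_recr//= lerD//.
  apply: (@le_trans _ _ (\sum_((2 ^ m).-1 <= i < (2 ^ m).-1 + 2 ^ m) ((2 ^ m)%:R `^ s)^-1)).
    rewrite big_nat [leRHS]big_nat; apply: ler_sum => i /andP[mi _].
    rewrite lef_pV2 ?posrE ?powR_gt0 ?ltr0n//.
    by apply: ge0_ler_powR => //; rewrite ?nnegrE ?ler0n// ler_nat; lia.
  rewrite sumr_const_nat addKn mul1r -[leLHS]mulr_natl natrX -!powR_mulrn//.
  rewrite /q -!powRrM -powRB ?pnatr_eq0 ?implybT//.
  by rewrite [in leRHS]mulrC mulrBr mulr1.
apply: nondecreasing_is_cvgn => //; exists (1 - q)^-1 => _ [n _ <-].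
apply: (@le_trans _ _ (series (riemannR s) (2 ^ n).-1)).
  by apply: nd; have := ltn_expl n (isT : 1 < 2)%N; lia.
apply: (le_trans (dyadic n)); rewrite geometric_seriesE ?lt_eqF//=.
rewrite mul1r; apply: ler_piMl; first by rewrite invr_ge0 subr_ge0 ltW.
by rewrite gerBl exprn_ge0.
Qed.

Lemma series_riemannR_le_zeta s n : 1 < s -> series (riemannR s) n <= zeta s.
Proof.
move=> s1; apply: nondecreasing_cvgn_le; last exact: riemannR_cvg.
apply: nondecreasing_series => m _ _; rewrite ltW// riemannR_gt0//.
by rewrite (le_trans ler01)// ltW.
Qed.

Lemma zeta_ge0 s : 1 < s -> 0 <= zeta s.
Proof.
by move=> s1; have := series_riemannR_le_zeta s 0 s1; rewrite /series/= big_geq.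
Qed.

(** The index [M] is frequency 0 and contributes 1; the frequencies -M..-1 and 1..M give one partial
    series each. *)
Lemma sum_inv_powR_box s M :
  \sum_(i < M.*2.+1) (if (val i)%:Z - M%:Z == 0 then 1
     else (`|(val i)%:Z - M%:Z|%:~R `^ s)^-1) = 1 + 2 * series (riemannR s) M :> R.
Proof.
rewrite -(big_mkord xpredT (fun i => if i%:Z - M%:Z == 0 then 1
   else (`|i%:Z - M%:Z|%:~R `^ s)^-1 : R)).
rewrite (big_cat_nat (n := M)) ?leq0n//=; last by lia.
rewrite [X in _ + X]big_nat_recl ?subrr ?eqxx/=; last by lia.
rewrite addrCA; congr (1 + _).
have H (n : nat) (i : int) : `|i| = n.+1%:Z ->
    (if i == 0 then 1 else (`|i|%:~R `^ s)^-1) = riemannR s n :> R.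
  by move=> ni; rewrite ni; case: eqP ni => // ->.
rewrite mulr2n mulrDl mul1r; congr (_ + _).
  rewrite /series big_nat_rev/= !big_nat; apply: eq_bigr => i /andP[_ iM].
  by apply: H; lia.
rewrite /series -{1}[M]add0n big_addn -addnn addnK /= !big_nat; apply: eq_bigr => i _.
by apply: H; lia.
Qed.

(** The quotient of the univariate weights of orders [b] and [a] in [r1_ratio]. *)
Definition inv_powR_weight s h : R := if h == 0 then 1 else (`|h|%:~R `^ s)^-1.

Lemma inv_powR_weight_ge0 s h : 0 <= inv_powR_weight s h.
Proof. by rewrite /inv_powR_weight; case: ifP => // _; rewrite invr_ge0 powR_ge0. Qed.

Section multivariate.
Context {d : nat}.
Implicit Types (gam : 'I_d -> R) (u v : freq d).

Lemma sqrt_rw_submul a gam u v : 0 < a -> (forall j, 0 < gam j <= 1) ->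
  Num.sqrt (rw a gam u) <=
    cagd a gam * Num.sqrt (rw a gam v) * Num.sqrt (rw a gam (v + u)).
Proof.
move=> a0 gam01.
have r1_ge0 b c h : 0 <= r1 b c h by rewrite (le_trans ler01)// r1_ge1.
have max_ge0 j : 0 <= Num.max 1 (2 `^ (2 * a) * gam j) by rewrite le_max ler01.
have p_ge0 : 0 <= \prod_(j < d) Num.max 1 (2 `^ (2 * a) * gam j) by apply: prodr_ge0.
have rw_ge0 : 0 <= rw a gam v by apply: prodr_ge0.
rewrite /cagd -sqrtrM// -sqrtrM; last exact: mulr_ge0.
rewrite ler_wsqrtr// /rw -!big_split/=; apply: ler_prod => j _.
by rewrite r1_ge0/= ffunE r1_submul.
Qed.

Lemma rw_ratio a b s gam u : 0 < a -> 0 < b -> (forall j, 0 < gam j <= 1) ->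
  2 * a = 2 * b + s ->
  rw b gam u = rw a gam u * \prod_(j < d) inv_powR_weight s (u j).
Proof.
move=> a0 b0 gam01 abs; rewrite /rw -big_split/=; apply: eq_bigr => j _.
exact: r1_ratio.
Qed.

(** The box is a product of intervals, so the sum factors into [d] one-dimensional sums. *)
Lemma fsum_box_inv_powR s M : 1 < s ->
  \sum_(u \in box M) \prod_(j < d) inv_powR_weight s (u j) <= (1 + 2 * zeta s) ^+ d.
Proof.
move=> s1; rewrite fsum_boxE.
under eq_bigr do under eq_bigr do rewrite ffunE.
rewrite -(bigA_distr_bigA (fun (j : 'I_d) (i : 'I_(M.*2.+1)) =>
  inv_powR_weight s ((val i)%:Z - M%:Z))).
rewrite -[X in _ ^+ X]card_ord -prodr_const; apply: ler_prod => j _.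
rewrite sumr_ge0/=; last by move=> i _; exact: inv_powR_weight_ge0.
by rewrite sum_inv_powR_box lerD2l ler_wpM2l// series_riemannR_le_zeta.
Qed.

(** All factors of [rw] are at least 1, so each alone is at most [nu]; as [gam j <= 1], this bounds
    every nonzero coordinate by |nu|^(1/(2a)). *)
Lemma finite_hcross a gam (nu : R) : 0 < a -> (forall j, 0 < gam j <= 1) ->
  finite_set (hcross a gam nu).
Proof.
move=> a0 gam01.
have /(sub_finite_set _) : finite_set (box (d := d) (Num.truncn (`|nu| `^ (2 * a)^-1)).+1).
  exact: finite_box.
apply => u /= unu j; rewrite leNgt; apply/negP => Mu.
have uj0 : u j != 0 by move: Mu; lia.
have : r1 a (gam j) (u j) <= nu.
  apply: le_trans unu; rewrite /rw (bigD1 j)//= ler_peMr//.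
    by rewrite (le_trans ler01)// r1_ge1.
  apply: (big_ind (fun z => 1 <= z)) => // [z t|i _]; [exact: mulr_ege1|exact: r1_ge1].
rewrite r1E// ler_pdivrMr//; last by have /andP[] := gam01 j.
have [gam0 gam1] := andP (gam01 j).
have a20 : 2 * a != 0 by rewrite mulf_neq0 ?gt_eqF.
move=> unugam.
have {unugam} : `|u j|%:~R `^ (2 * a) <= `|nu|.
  apply: (le_trans unugam); apply: (@le_trans _ _ (`|nu| * gam j)).
    by rewrite ler_wpM2r ?ler_norm// ltW.
  by rewrite ler_piMr.
move=> /(@ge0_ler_powR R (2 * a)^-1); rewrite ?nnegrE ?powR_ge0// -powRrM mulfV//.
rewrite powRr1 ?ler0z// => /(_ _ isT (normr_ge0 _)) H.
have : (`|u j|%:~R : R) < (Num.truncn (`|nu| `^ (2 * a)^-1)).+1%:R.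
  apply: le_lt_trans (H _) _; first by rewrite invr_ge0 mulr_ge0// ltW.
  by have /andP[] := truncn_itv (powR_ge0 `|nu| (2 * a)^-1).
by rewrite -[ltRHS]/((Posz _)%:~R) ltr_int; move: Mu; lia.
Qed.

End multivariate.

End weights.

(** * The product of a Wiener function and a trigonometric polynomial *)

Section wiener_times_trigonometric.
Context {R : realType} {d : nat}.
Variables (alpha : R) (gam : 'I_d -> R) (g : pnt R d -> R[i]).
Hypothesis gW : in_wiener alpha gam g.
Variables (K : set (freq d)) (psi : freq d -> R[i]).
Hypothesis finK : finite_set K.
Implicit Types (k h : freq d) (x : pnt R d).

(** This is [phiK] when [psi] is [phicheck xs c]; free coefficients permit rescaling. *)
Definition trigpoly x : R[i] := \sum_(k \in K) psi k * (omega k x)^*%C.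

Lemma cucont_mul_omega k : cucont (fun x => g x * (omega k x)^*%C).
Proof.
apply: (@cucontM _ _ _ _ (wiener_norm alpha gam g) 1).
- exact: wiener_bounded.
- by move=> x _; rewrite normc_conj normc_omega.
- exact: wiener_cucont gW.
- move=> e /(cucont_omega k)[del del0 H]; exists del => // x y cx cy xy.
  by rewrite -rmorphB normc_conj H.
Qed.

Lemma cint_mul_trigpoly : cint (fun x => g x * trigpoly x) = \sum_(k \in K) psi k * fcoef g k.
Proof.
rewrite fsbig_finite// -cint_sum; last exact: cucont_mul_omega.
congr cint; apply/funext => x; rewrite /trigpoly fsbig_finite// mulr_sumr.
by apply: eq_bigr => k _; rewrite mulrCA.
Qed.

Lemma fcoef_mul_trigpoly h :
  fcoef (fun x => g x * trigpoly x) h = \sum_(k \in K) psi k * fcoef g (k + h).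
Proof.
rewrite fsbig_finite// -cint_sum; last by move=> k; exact: cucont_mul_omega.
congr cint; apply/funext => x; rewrite /trigpoly fsbig_finite// mulr_sumr mulr_suml.
apply: eq_bigr => k _; rewrite omegaD rmorphM/=; ring.
Qed.

(** Exchanging the sums over [h] and [k] and substituting [u = k + h] turns a box sum of the product
    into sums of the series of [g] over translated boxes. *)
Lemma mul_trigpoly_fpsumB M x : g x * trigpoly x - fpsum (fun x => g x * trigpoly x) M x =
  \sum_(k \in K) psi k * (omega k x)^*%C *
    (g x - \sum_(u \in [set k + h | h in box M]) fcoef g u * omega u x).
Proof.
have -> : fpsum (fun x => g x * trigpoly x) M x = \sum_(k \in K) psi k * (omega k x)^*%C *
    \sum_(u \in [set k + h | h in box M]) fcoef g u * omega u x.
  rewrite /fpsum; under eq_fsbigr do rewrite fcoef_mul_trigpoly mulr_fsuml.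
  rewrite exchange_fsbig//; last exact: finite_box.
  apply: eq_fsbigr => k _; rewrite fsbig_image; last by move=> ? ? _ _; exact: addrI.
  rewrite mulr_fsumr; apply: eq_fsbigr => h _; rewrite omegaD.
  rewrite -[LHS]mulr1 -(omega_conjM k x); ring.
rewrite /trigpoly !fsbig_finite// mulr_sumr -sumrB; apply: eq_bigr => k _.
by rewrite mulrBr [in RHS]mulrC -mulrA mulrC.
Qed.

(** If [K] lies in [box m], each translate of [box M] by a point of [K] contains [box (M - m)], so
    the remainder is at most a constant times the tail at [M - m]. *)
Lemma mul_trigpoly_fourier_rep : fourier_rep (fun x => g x * trigpoly x).
Proof.
move=> x cx; have [m Km] := finite_subset_box _ finK.
pose tail M := wiener_norm alpha gam g - wiener_psum alpha gam g M.
pose S := \sum_(k \in K) normc (psi k).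
have tail0 : S * tail (M - m)%N @[M --> \oo] --> (0 : R).
  rewrite -(mulr0 S); apply: cvgMr; apply: (cvg_comp (fun M => M - m)%N tail).
    exact: cvg_subnr.
  exact: wiener_psum_tail gW.
apply: (squeeze_cvgr _ (cvg_cst 0) tail0).
near=> M; have mM : (m <= M)%N by near: M; exact: nbhs_infty_ge.
rewrite normc_ge0/= normc_sub mul_trigpoly_fpsumB.
apply: le_trans (ler_normc_fsum _ _ finK) _; rewrite /S mulr_fsuml.
apply: ler_fsum => // k Kk; rewrite !Normc.normcM normc_conj normc_omega mulr1.
rewrite ler_wpM2l ?normc_ge0//; apply: fourier_tail_box => //.
  by apply: finite_image; exact: finite_box.
move=> u uM; exists (u - k); last by rewrite addrC subrK.
have H (a b : int) : `|a| <= (M - m)%N%:Z -> `|b| <= m%:Z -> `|a - b| <= M%:Z by lia.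
by move=> j; rewrite !ffunE; exact: H (uM j) (Km _ Kk j).
Unshelve. all: by end_near. Qed.

Section korobov.
Variables (beta s nu m : R).
Hypotheses (gam01 : forall j, 0 < gam j <= 1) (alpha0 : 0 < alpha) (beta0 : 0 < beta)
  (s1 : 1 < s) (alpha_beta : 2 * alpha = 2 * beta + s).
Hypotheses (Knu : K `<=` hcross alpha gam nu) (psim : forall k, normc (psi k) <= m).

(** Submultiplicativity is used with [v := k]; on [K] the weight is at most [nu], and what remains
    is a sum of [wterm] over the translate of [K] by [h], at most the Wiener norm. *)
Lemma weighted_fcoef_mul_trigpoly h :
  Num.sqrt (rw alpha gam h) * normc (fcoef (fun x => g x * trigpoly x) h)
    <= cagd alpha gam * Num.sqrt nu * m * wiener_norm alpha gam g.
Proof.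
have m0 : 0 <= m by apply: le_trans (psim 0); exact: normc_ge0.
rewrite fcoef_mul_trigpoly.
apply: le_trans (ler_wpM2l (sqrtr_ge0 _) (ler_normc_fsum _ _ finK)) _.
rewrite mulr_fsumr.
apply: (@le_trans _ _
  (\sum_(k \in K) cagd alpha gam * Num.sqrt nu * m * wterm alpha gam g (k + h))).
  apply: ler_fsum => // k Kk; rewrite Normc.normcM mulrCA.
  apply: le_trans (ler_wpM2r _ (psim k)) _; first by rewrite mulr_ge0 ?sqrtr_ge0 ?normc_ge0.
  rewrite mulrC /wterm -[leRHS]mulrA -[leRHS]mulrA [m * _]mulrC !mulrA ler_wpM2r//.
  rewrite ler_wpM2r ?normc_ge0//; apply: le_trans (sqrt_rw_submul _ _ _ k alpha0 gam01) _.
  by rewrite ler_wpM2r ?sqrtr_ge0// ler_wpM2l ?sqrtr_ge0// ler_wsqrtr// Knu.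
rewrite -mulr_fsumr; apply: ler_wpM2l; first by rewrite !mulr_ge0 ?sqrtr_ge0.
rewrite -(fsbig_image _ (fun k => k + h)); last by move=> ? ? _ _; exact: addIr.
by apply: fsum_wterm_le => //; exact: finite_image.
Qed.

Lemma korobov_psum_mul_trigpoly M :
  korobov_psum beta gam (fun x => g x * trigpoly x) M <=
    (cagd alpha gam * Num.sqrt nu * m * wiener_norm alpha gam g) ^+ 2
    * (1 + 2 * zeta s) ^+ d.
Proof.
set T := cagd _ _ * _ * _ * _.
apply: (@le_trans _ _ (\sum_(h \in box M) T ^+ 2 * \prod_(j < d) inv_powR_weight s (h j))).
  apply: ler_fsum => [|h _]; first exact: finite_box.
  (* Passing to order [alpha] leaves the square of the uniformly bounded quantity times a summable
     factor. *)
  rewrite (rw_ratio alpha beta s)// mulrAC ler_wpM2r//.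
    by apply: prodr_ge0 => j _; exact: inv_powR_weight_ge0.
  rewrite -[X in X * _]sqr_sqrtr ?(le_trans ler01) ?rw_ge1//.
  rewrite -exprMn lerXn2r ?nnegrE ?weighted_fcoef_mul_trigpoly//.
    by rewrite mulr_ge0 ?sqrtr_ge0 ?normc_ge0.
  by apply: le_trans (weighted_fcoef_mul_trigpoly 0); rewrite mulr_ge0 ?sqrtr_ge0 ?normc_ge0.
by rewrite -mulr_fsumr ler_wpM2l ?sqr_ge0// fsum_box_inv_powR.
Qed.

Lemma korobov_mul_trigpoly :
  cvgn (korobov_psum beta gam (fun x => g x * trigpoly x)) /\
  korobov_norm beta gam (fun x => g x * trigpoly x) <=
    cagd alpha gam * Num.sqrt nu * m * wiener_norm alpha gam g * zetad d ((s - 1) / 2).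
Proof.
have cv : cvgn (korobov_psum beta gam (fun x => g x * trigpoly x)).
  apply: nondecreasing_is_cvgn.
    move=> M N MN; apply: ler_fsum_subset; [exact: finite_box|exact: subset_box|].
    by move=> h; rewrite mulr_ge0 ?sqr_ge0// (le_trans ler01)// rw_ge1.
  by eexists => _ [M _ <-]; exact: korobov_psum_mul_trigpoly.
split=> //; rewrite /korobov_norm /zetad.
set T := cagd _ _ * _ * _ * _.
have T0 : 0 <= T.
  by apply: le_trans (weighted_fcoef_mul_trigpoly 0); rewrite mulr_ge0 ?sqrtr_ge0 ?normc_ge0.
have z0 := zeta_ge0 s s1.
rewrite -[leRHS]ger0_norm; last by rewrite mulr_ge0 ?powR_ge0.
rewrite -sqrtr_sqr ler_wsqrtr//.
apply: limr_le => //; apply: nearW => M.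
apply: le_trans (korobov_psum_mul_trigpoly M) _; rewrite [leRHS]exprMn.
apply: ler_wpM2l; first exact: sqr_ge0.
(* The argument of [zetad] is chosen so that its zeta value is taken at [s]. *)
have -> : 1 + 2 * ((s - 1) / 2) = s by field.
rewrite -[X in _ <= X]powR_mulrn ?powR_ge0// -powRrM divfK ?pnatr_eq0//.
by rewrite powR_mulrn// addr_ge0// mulr_ge0.
Qed.

End korobov.

End wiener_times_trigonometric.

(** * The two error bounds *)

Section quadrature.
Context {R : realType} {d : nat}.
Variables (alpha : R) (gam : 'I_d -> R) (g : pnt R d -> R[i]) (nu : R).
Hypotheses (alpha0 : 0 < alpha) (gam01 : forall j, 0 < gam j <= 1) (nu0 : 0 < nu).
Hypothesis gW : in_wiener alpha gam g.
Let K := hcross alpha gam nu.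
Let finK : finite_set K := finite_hcross alpha gam nu alpha0 gam01.

(** The error is homogeneous in [psi]. Since the norm bound [T] may be 0, division is by an
    arbitrary t > T, and t then decreases to [T]. *)
Lemma qmc_error_mul_trigpoly (psi : freq d -> R[i]) (beta s m E : R)
    (L : nat) (z : 'I_L -> pnt R d) :
  0 < beta -> 1 < s -> 2 * alpha = 2 * beta + s -> (forall k, normc (psi k) <= m) ->
  (wce beta gam z <= E%:E)%E ->
  normc (cint (fun x => g x * trigpoly K psi x) - qmc z (fun x => g x * trigpoly K psi x))
    <= cagd alpha gam * Num.sqrt nu * m * wiener_norm alpha gam g * zetad d ((s - 1) / 2) * E.
Proof.
move=> beta0 s1 abs psim zE; set T := cagd _ _ * _ * _ * _ * _; set err := normc _.
have T0 : 0 <= T.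
  have [_] := korobov_mul_trigpoly alpha gam g gW K psi finK beta s nu m gam01 alpha0
    beta0 s1 abs (@subset_refl _ _) psim.
  by apply: le_trans; exact: sqrtr_ge0.
(* Scaling the weights psi by 1 / t for t > T puts the product into the unit ball. *)
have scaled t : T < t -> err <= t * E.
  move=> Tt; have t0 : 0 < t := le_lt_trans T0 Tt.
  pose psit k := (t^-1)%:C%C * psi k.
  have psitm k : normc (psit k) <= t^-1 * m.
    by rewrite Normc.normcM normc_real ger0_norm ?invr_ge0 ?ler_wpM2l ?invr_ge0// ltW.
  have trigt x : trigpoly K psit x = (t^-1)%:C%C * trigpoly K psi x.
    by rewrite /trigpoly mulr_fsumr; apply: eq_fsbigr => k _; rewrite mulrA.
  have [kcv knorm] := korobov_mul_trigpoly alpha gam g gW K psit finK beta s nu _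
    gam01 alpha0 beta0 s1 abs (@subset_refl _ _) psitm.
  have ball : korobov_ball beta gam (fun x => g x * trigpoly K psit x).
    split; first exact: mul_trigpoly_fourier_rep gW _ _ finK.
    split => //; apply: (le_trans knorm); rewrite -[leRHS](mulVf (lt0r_neq0 t0)).
    rewrite [leLHS](_ : _ = t^-1 * T); last by rewrite /T; ring.
    by rewrite ler_wpM2l ?invr_ge0// ltW.
  have : normc (cint (fun x => g x * trigpoly K psit x)
      - qmc z (fun x => g x * trigpoly K psit x)) <= E.
    rewrite -lee_fin; apply: le_trans zE; apply: ereal_sup_ubound.
    by exists (fun x => g x * trigpoly K psit x).
  have -> : cint (fun x => g x * trigpoly K psit x)
      - qmc z (fun x => g x * trigpoly K psit x) =
    (t^-1)%:C%C * (cint (fun x => g x * trigpoly K psi x)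
      - qmc z (fun x => g x * trigpoly K psi x)).
    rewrite mulrBr !(cint_mul_trigpoly _ _ _ gW)// mulr_fsumr; congr (_ - _).
      by apply: eq_fsbigr => k _; rewrite mulrA.
    rewrite /qmc mulrCA; congr (_ * _); rewrite mulr_sumr; apply: eq_bigr => l _.
    by rewrite trigt mulrCA.
  rewrite Normc.normcM normc_real ger0_norm; last by rewrite invr_ge0 ltW.
  by rewrite ler_pdivrMl.
(* Read off from 0 <= err <= (T + 1) E. *)
have E0 : 0 <= E.
  have := scaled (T + 1); rewrite ltrDl ltr01 => /(_ isT) /(le_trans (normc_ge0 _)).
  by rewrite pmulr_rge0// ltr_wpDl.
apply/ler_addgt0Pr => e e0; have E1 : 0 < E + 1 by rewrite ltr_wpDl.
apply: (le_trans (scaled (T + e / (E + 1)) _)); first by rewrite ltrDl divr_gt0.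
rewrite mulrDl lerD2l mulrAC ler_pdivrMr//.
by apply: ler_wpM2l; [exact: ltW|rewrite lerDl].
Qed.

Lemma normc_phicheck_le (N : nat) (xs : 'I_N -> pnt R d) (c : 'I_N -> R) k :
  normc (phicheck xs c k) <= mubar c.
Proof.
rewrite /phicheck /mubar Normc.normcM Normc.normcV normc_nat ler_wpM2l ?invr_ge0//.
apply: le_trans (ler_normc_sum _ _ _ _) _; apply: ler_sum => n _.
by rewrite Normc.normcM normc_omega mulr1 normc_real.
Qed.

(** The integral of [g * phiK] equals the weighted node sum of the Fourier series of [g] truncated
    to [K], so only the tails at the nodes remain. *)
Lemma err1_le (N : nat) (xs : 'I_N -> pnt R d) (c : 'I_N -> R) :
  (forall n, in_cube (xs n)) ->
  err1 K xs c g <= wiener_norm alpha gam g / Num.sqrt nu * mubar c.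
Proof.
move=> cxs; rewrite /err1.
have -> : cint (fun x => g x * phiK K xs c x) =
    (N%:R)^-1 * \sum_(n < N) (c n)%:C%C * \sum_(k \in K) fcoef g k * omega k (xs n).
  rewrite [LHS](cint_mul_trigpoly _ _ _ gW)// /phicheck.
  under eq_fsbigr do rewrite -mulrA mulr_suml.
  rewrite -mulr_fsumr; congr (_ * _); rewrite fsbig_finite// exchange_big/=.
  apply: eq_bigr => n _; rewrite fsbig_finite// mulr_sumr.
  by apply: eq_bigr => k _; rewrite -mulrA [_ * fcoef g k]mulrC.
rewrite -mulrBr -sumrB; under eq_bigr do rewrite -mulrBr.
rewrite Normc.normcM Normc.normcV normc_nat /mubar mulrCA ler_wpM2l ?invr_ge0//.
apply: le_trans (ler_normc_sum _ _ _ _) _; rewrite mulr_sumr; apply: ler_sum => n _.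
rewrite Normc.normcM normc_real mulrC ler_wpM2r//.
apply: (fourier_tail _ _ _ gW) => // D finD DK.
rewrite ler_pdivlMr ?sqrtr_gt0//; apply: le_trans (fsum_wterm_le _ _ _ gW _ finD).
(* Outside the cross the weight exceeds [nu], so sqrt nu times the coefficient is at most
   [wterm]. *)
rewrite mulr_fsuml; apply: ler_fsum => // k /DK /negP; rewrite -ltNge => nuk.
by rewrite mulrC ler_wpM2r ?normc_ge0// ler_wsqrtr// ltW.
Qed.

End quadrature.

(** * Combination of the two bounds for the lattice rule *)

Theorem theorem3p8 (R : realType) (alpha delta tau : R) (d : nat)
  (gam : 'I_d -> R) (g : pnt R d -> R[i])
  (N : nat) (xs : 'I_N -> pnt R d) (c : 'I_N -> R)
  (L : nat) (gen : 'I_d -> nat) :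
  1 < alpha -> 0 < delta -> delta < alpha - 1 ->
  0 < tau -> tau <= alpha - 1 - delta ->
  (forall j, 0 < gam j <= 1) ->
  (forall i j : 'I_d, (i <= j)%N -> gam j <= gam i) ->
  in_wiener alpha gam g ->
  (0 < N)%N -> (forall n, in_cube (xs n)) ->
  prime L -> (forall j, (0 < gen j < L)%N) ->
  (forall tau' : R, 0 < tau' -> tau' <= (alpha - 1 / 2 - delta) - 1 / 2 ->
     (wce (alpha - 1 / 2 - delta) gam (lattice R (L:=L) gen)
       <= (Cgd gam (alpha - 1 / 2 - delta) tau'
           * L%:R `^ (- (alpha - 1 / 2 - delta) + tau'))%:E)%E) ->
  forall nu : R, 1 < nu ->
  let K := hcross alpha gam nu in
  Normc.normc ((N%:R)^-1 * \sum_(n < N) (c n)%:C%C * g (xs n)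
               - qmc (lattice R (L:=L) gen) (fun x => g x * phiK K xs c x))
    <= err1 K xs c g + err2 K xs c (lattice R (L:=L) gen) g
  /\ err1 K xs c g + err2 K xs c (lattice R (L:=L) gen) g
    <= wiener_norm alpha gam g
       * (1 / Num.sqrt nu
          + Num.sqrt nu / L%:R `^ (alpha - 1 / 2 - delta - tau)
            * cagd alpha gam * zetad d delta
            * Cgd gam (alpha - 1 / 2 - delta) tau)
       * mubar c.
Proof.
move=> alpha1 delta0 deltaa tau0 taua gam01 _ gW _ cxs _ _ wceE nu nu1 K.
split; first exact: ler_dist_normcD.
have alpha0 : 0 < alpha := lt_trans ltr01 alpha1.
have nu0 : 0 < nu := lt_trans ltr01 nu1.
have le1 := err1_le alpha gam g nu alpha0 gam01 nu0 gW N xs c cxs.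
(* The choice beta = alpha - 1/2 - delta leaves the surplus exponent s = 1 + 2 delta, just enough
   for summability. *)
have [beta0 s1] : 0 < alpha - 1 / 2 - delta /\ 1 < 1 + 2 * delta by split; lra.
have ab : 2 * alpha = 2 * (alpha - 1 / 2 - delta) + (1 + 2 * delta) by field.
have tau_le : tau <= alpha - 1 / 2 - delta - 1 / 2 by lra.
have := qmc_error_mul_trigpoly alpha gam g nu alpha0 gam01 gW (phicheck xs c)
  _ _ (mubar c) _ L (lattice R gen) beta0 s1 ab
  (normc_phicheck_le N xs c) (wceE tau tau0 tau_le).
have -> : (1 + 2 * delta - 1) / 2 = delta by field.
(* A negated exponent lets [powRN] produce the quotient by the power of [L]. *)
rewrite (_ : - (alpha - 1 / 2 - delta) + tau = - (alpha - 1 / 2 - delta - tau)); last by ring.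
rewrite powRN => le2.
apply: (le_trans (lerD le1 le2)); rewrite le_eqVlt; apply/orP; left; apply/eqP.
by rewrite mulrDr mulrDl mul1r; congr (_ + _); ring.
Qed.
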